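(* Let $\sigma>0$ and $f\in B_\sigma$. Under the interpolation conditions described in the context (with $b_0>0$ any positive number), for any fixed $\delta$, $0<\delta\le b_0$, the optimal choice of $\beta$ in the interval $(0,\beta_0]$, where $$\beta_0=\frac{1}{144\sqrt2\,e\,b_0^{3/2}\sqrt\delta},$$ is the number minimizing $$MN(\beta):=\beta^{\frac{b_0}{2\delta}}\,e^{\frac{\sigma^2}{8\beta}},\qquad \beta\in(0,\beta_0].$$
   Context: $n\ge1$ is the dimension, $\rho=\sqrt3/e$, and $\alpha_n$ is the volume of the unit ball in $R^n$. $B_\sigma=\{f\in L^2(R^n):\hat f(\xi)=0\text{ if }|\xi|>\sigma\}$, where $\hat f$ denotes the Fourier transform of $f$. Interpolation conditions: $h(x)=e^{-\beta|x|^2}$, $x\in R^n$, $\beta>0$, is the Gaussian with shape parameter $\beta$. The $h$ spline interpolating $f$ on $X=\{x_1,\dots,x_N\}\subset R^n$ is $s(x)=\sum_{j=1}^Nc_jh(x-x_j)$ with $s(x_i)=f(x_i)$ for $i=1,\dots,N$. For an $n$-simplex in $R^n$ with vertices $v_1,\dots,v_{n+1}$, the evenly spaced points of degree $l$ are the points $\sum_{i=1}^{n+1}\frac{k_i}{l}v_i$ with nonnegative integers $k_i$, $\sum_{i=1}^{n+1} k_i=l$. The point $x$ lies in a set $\Omega\subseteq R^n$ with the property that for any $x\in\Omega$ and any number $r$ with $\frac{b_0}{2}\le r\le b_0$ there is an $n$-simplex $Q$ of diameter $r$ with $x\in Q\subseteq\Omega$ such that for any integer $l$ with $\frac{b_0}{\delta}\le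 l\le\frac{2b_0}{\delta}$ there is on $Q$ an evenly spaced set of centers from $X$ of degree $l-1$. (If $x\in\Omega$ is fixed, it is only required that there be one such simplex $Q$, with diameter $r$ and $x\in Q\subseteq\Omega$, having this property of evenly spaced centers, and the centers of $s$ are just the evenly spaced points in $Q$.) Moreover $0<\delta\le\delta_0$, where $$\delta_0=\min\left\{b_0,\ \frac{1}{\rho_3^4\cdot3^3\cdot2^7\cdot b_0^3}\right\},\qquad \rho_3=12^{1/4}\sqrt{e\beta};$$ this condition is equivalent to $\delta\le b_0$ together with $\beta\le\beta_0$. Under these conditions $$|f(x)-s(x)|\le c_1\sqrt\delta\,(c_2\delta)^{c_3/\delta}(2\pi)^{-n}e^{\frac{\sigma^2}{8\beta}}\|f\|_{L^2(R^n)},$$ where $c_1=\frac{\Delta''}{\sqrt{16\pi}\sqrt{b_0}}$, $c_2=\rho_3^4\cdot3^3\cdot2^7\cdot b_0^3$, $c_3=\frac{b_0}{4}$, $\Delta''=\sqrt{2+\frac1e}\,\pi^{\frac{n-1}{4}}(n\alpha_n)^{1/2}2^{\frac n4}\rho^{\frac{n-1}{4}}$ for odd $n$ and $\Delta''=\pi^{\frac{n-1}{4}}(n\alpha_n)^{1/2}2^{\frac{n+1}{4}}\rho^{\frac{n-2}{4}}$ for even $n$. ''Optimal'' means that the right-hand side of this error bound, as a function of $\beta$, is minimal. *)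

(* Defs.v *)
From HB Require Import structures.
From mathcomp Require Import all_boot all_order all_algebra.
From mathcomp Require Import all_classical all_reals all_analysis.
From mathcomp Require Import complex ring.
Set Implicit Arguments.
Unset Strict Implicit.
Unset Printing Implicit Defensive.
Import Order.TTheory GRing.Theory Num.Theory.
Import numFieldNormedType.Exports.
Local Open Scope classical_set_scope.
Local Open Scope ring_scope.

(* R^n is 'rV[R]_n, with the sigma-algebra generated by the coordinates. *)
Section measurable_rV.
Variables (R : realType) (n : nat).

Let coord (i : 'I_n) (v : 'rV[R]_n) : R := v ord0 i.

Let rV_set0 : g_sigma_preimage coord set0.
Proof. exact: sigma_algebra0. Qed.

Let rV_setC A : g_sigma_preimage coord A -> g_sigma_preimage coord (~` A).
Proof. exact: sigma_algebraC. Qed.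

Let rV_bigcup (F : (set 'rV[R]_n)^nat) :
  (forall i, g_sigma_preimage coord (F i)) ->
  g_sigma_preimage coord (\bigcup_i F i).
Proof. exact: sigma_algebra_bigcup. Qed.

HB.instance Definition _ := @isMeasurable.Build default_measure_display
  'rV[R]_n (g_sigma_preimage coord) rV_set0 rV_setC rV_bigcup.

Lemma measurable_coord (i : 'I_n) :
  measurable_fun [set: 'rV[R]_n] (fun v : 'rV[R]_n => v ord0 i).
Proof.
move=> _ Y mY; rewrite setTI; apply: sub_sigma_algebra => /=.
rewrite -bigcup_seq/=; exists i => /=; first by rewrite mem_index_enum.
by exists Y => //; rewrite setTI.
Qed.

Lemma measurable_fun_rV d (T : measurableType d) (f : T -> 'rV[R]_n) :
  (forall i, measurable_fun [set: T] (fun t => f t ord0 i)) ->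
  measurable_fun [set: T] f.
Proof.
move=> mf _ B mB; rewrite setTI.
suff: g_sigma_preimage coord `<=` (fun B => measurable (f @^-1` B)) by apply.
apply: smallest_sub.
  split => /=; first by rewrite preimage_set0.
  - by move=> A mA; rewrite setTD preimage_setC; exact: measurableC.
  - by move=> F mF; rewrite preimage_bigcup; exact: bigcup_measurable.
move=> A; rewrite -bigcup_seq => -[i _ [Y mY <-]] /=.
by have := mf i measurableT _ mY; rewrite !setTI.
Qed.

End measurable_rV.

(* Lebesgue measure on R^n, as the n-fold product of lebesgue_measure. *)
Section lebesgue_rV.
Variable R : realType.

Definition rV_cons n (p : measurableTypeR R * 'rV[R]_n) : 'rV[R]_n.+1 :=
  \row_i (if unlift ord0 i is Some j then p.2 ord0 j else p.1).

Definition rV_uncons n (v : 'rV[R]_n.+1) : measurableTypeR R * 'rV[R]_n :=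
  (v ord0 ord0, \row_j v ord0 (lift ord0 j)).

Lemma rV_consK n : cancel (@rV_cons n) (@rV_uncons n).
Proof.
move=> [a v]; rewrite /rV_uncons mxE unlift_none /=; congr pair.
by apply/rowP => j; rewrite !mxE liftK.
Qed.

Lemma measurable_rV_cons n : measurable_fun [set: _] (@rV_cons n).
Proof.
apply: measurable_fun_rV => i; under eq_fun do rewrite mxE.
case: unliftP => [j _|_]; last exact: measurable_fst.
exact: measurableT_comp (measurable_coord j) measurable_snd.
Qed.

Lemma measurable_rV_uncons n : measurable_fun [set: _] (@rV_uncons n).
Proof.
apply/measurable_fun_pairP; split; first exact: (@measurable_coord R n.+1 ord0).
apply: measurable_fun_rV => i /=; under eq_fun do rewrite mxE.
exact: (@measurable_coord R n.+1 (lift ord0 i)).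
Qed.

Section step.
Variables (n : nat) (m : {sigma_finite_measure set 'rV[R]_n -> \bar R}).

Definition lebesgue_rV_step : set 'rV[R]_n.+1 -> \bar R :=
  pushforward (@lebesgue_measure R \x m)%E (@rV_cons n).

Let step0 : lebesgue_rV_step set0 = 0%E.
Proof. by rewrite /lebesgue_rV_step /pushforward preimage_set0 measure0. Qed.

Let step_ge0 A : (0 <= lebesgue_rV_step A)%E.
Proof. by rewrite /lebesgue_rV_step /pushforward; exact: measure_ge0. Qed.

Let step_sigma_additive : semi_sigma_additive lebesgue_rV_step.
Proof.
move=> F mF tF mUF; rewrite /lebesgue_rV_step /pushforward preimage_bigcup.
apply: measure_semi_sigma_additive.
- by move=> i; rewrite -[X in measurable X]setTI; exact: measurable_rV_cons.
- apply/trivIsetP => /= i j _ _ ij; rewrite -preimage_setI.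
  by move/trivIsetP : tF => /(_ _ _ _ _ ij) ->//; rewrite preimage_set0.
- by rewrite -preimage_bigcup -[X in measurable X]setTI; exact: measurable_rV_cons.
Qed.

HB.instance Definition _ := isMeasure.Build _ _ _ lebesgue_rV_step
  step0 step_ge0 step_sigma_additive.

Let step_sigma_finite : sigma_finite setT lebesgue_rV_step.
Proof.
have /sigma_finiteP[F [TF ndF Foo]] := sigma_finiteT (@lebesgue_measure R).
have /sigma_finiteP[G [TG ndG Goo]] := sigma_finiteT m.
exists (fun i => @rV_uncons n @^-1` (F i `*` G i)) => [|i].
  rewrite -preimage_bigcup; apply/esym; rewrite -subTset => v _ /=.
  have : setT (rV_uncons v).1 by []. rewrite TF => -[i _ Fi].
  have : setT (rV_uncons v).2 by []. rewrite TG => -[j _ Gj].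
  exists (maxn i j) => //; split.
  - by move: Fi; exact/subsetPset/ndF/leq_maxl.
  - by move: Gj; exact/subsetPset/ndG/leq_maxr.
have [mF Fi] := Foo i; have [mG Gi] := Goo i; split.
  rewrite -[X in measurable X]setTI; apply: measurable_rV_uncons => //.
  exact: measurableX.
rewrite /lebesgue_rV_step /pushforward -comp_preimage.
rewrite (_ : _ \o _ = id); last exact/funext/rV_consK.
by rewrite preimage_id product_measure1E// lte_mul_pinfty// ge0_fin_numE.
Qed.

HB.instance Definition _ := Measure_isSigmaFinite.Build _ _ _ lebesgue_rV_step
  step_sigma_finite.

End step.

Definition lebesgue_rV0 : set 'rV[R]_0 -> \bar R := dirac (0 : 'rV[R]_0).

HB.instance Definition _ := Measure.on lebesgue_rV0.

Let lebesgue_rV0_sigma_finite : sigma_finite setT lebesgue_rV0.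
Proof.
exists (fun=> setT); first by rewrite bigcup_const//; exists 0%N.
by move=> _; split; [exact: measurableT|rewrite /lebesgue_rV0 diracT ltry].
Qed.

HB.instance Definition _ := Measure_isSigmaFinite.Build _ _ _ lebesgue_rV0
  lebesgue_rV0_sigma_finite.

Fixpoint lebesgue_rV n : {sigma_finite_measure set 'rV[R]_n -> \bar R} :=
  match n with
  | 0 => lebesgue_rV0
  | n'.+1 => lebesgue_rV_step (lebesgue_rV n')
  end.

Lemma lebesgue_rV_box n (a b : 'rV[R]_n) :
  (forall i, a ord0 i < b ord0 i) ->
  let box := [set x : 'rV[R]_n | forall i, a ord0 i <= x ord0 i <= b ord0 i] in
  measurable box /\
  lebesgue_rV n box = (\prod_i (b ord0 i - a ord0 i))%:E.
Proof.
elim: n a b => [|n IH] a b ab B.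
  rewrite big_ord0 (_ : B = setT).
    by split=> //=; rewrite /lebesgue_rV0 diracT.
  by apply/seteqP; split=> // x _ [].
have ab' i : (\row_j a ord0 (lift ord0 j)) ord0 i <
             (\row_j b ord0 (lift ord0 j)) ord0 i by rewrite !mxE.
have /= := IH _ _ ab'; set C := [set x | _] => -[m1 m2].
have pre : @rV_cons n @^-1` B = `[a ord0 ord0, b ord0 ord0] `*` C.
  apply/seteqP; split=> -[t v] /=.
    move=> H; split; first by have := H ord0; rewrite /= mxE unlift_none in_itv.
    by move=> i; have := H (lift ord0 i); rewrite /= !mxE liftK.
  move=> [/= + H] i; rewrite in_itv /= => H0.
  rewrite mxE; case: unliftP => [j ->|-> //].
  by have := H j; rewrite !mxE.
have pre2 : B = @rV_uncons n @^-1` (`[a ord0 ord0, b ord0 ord0] `*` C).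
  rewrite -pre -comp_preimage (_ : _ \o _ = id) ?preimage_id//.
  apply/funext => v /=; apply/rowP => i; rewrite mxE.
  by case: unliftP => [j ->|-> //]; rewrite mxE.
have mB : measurable (`[a ord0 ord0, b ord0 ord0]%classic `*` C :
    set (measurableTypeR R * 'rV[R]_n)).
  by apply: measurableX => //; exact: measurable_itv.
split.
  rewrite pre2 -[X in measurable X]setTI; exact: measurable_rV_uncons.
rewrite /= /lebesgue_rV_step /pushforward pre product_measure1E;
  [|exact: measurable_itv|exact: m1].
rewrite m2 big_ord_recl.
rewrite [X in (X * _)%E](_ : _ = (b ord0 ord0 - a ord0 ord0)%:E); last first.
  have := lebesgue_measure_itv `[a ord0 ord0, b ord0 ord0].
  by rewrite /= lte_fin ab => H; exact: H.
rewrite EFinM; congr (_ * _%:E)%E.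
by apply: eq_bigr => j _; rewrite !mxE.
Qed.

End lebesgue_rV.
Arguments lebesgue_rV {R} n.

Section euclidean.
Variables (R : realType) (n : nat).
Implicit Types (x y : 'rV[R]_n) (A : set 'rV[R]_n).

Definition dotv x y : R := \sum_i x ord0 i * y ord0 i.

(* The library norm on 'rV[R]_n is the sup norm. *)
Definition enorm x : R := Num.sqrt (dotv x x).

Definition diam A : R := sup [set enorm (x - y) | x in A & y in A].

Definition unit_ball_volume : R :=
  fine (lebesgue_rV n [set x : 'rV[R]_n | enorm x <= 1]).

End euclidean.

Section band_limited.
Variables (R : realType) (n : nat).
Implicit Types f g : 'rV[R]_n -> R[i].

Definition L2enorm f : \bar R :=
  'N[lebesgue_rV n]_(2%:E)[EFin \o (@Normc.normc R) \o f].

Definition in_L2 f : Prop :=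
  [/\ measurable_fun [set: 'rV[R]_n] (fun x => complex.Re (f x)),
      measurable_fun [set: 'rV[R]_n] (fun x => complex.Im (f x)) &
      (L2enorm f < +oo)%E].

Definition L2norm f : R := fine (L2enorm f).

Definition cintegral (D : set 'rV[R]_n) f : R[i] :=
  Complex (\int[lebesgue_rV n]_(x in D) complex.Re (f x))%R
          (\int[lebesgue_rV n]_(x in D) complex.Im (f x))%R.

(* Fourier integral of f restricted to the ball of radius r:
   x |-> int_{|x| <= r} f(x) exp(- i x.xi) dx. *)
Definition truncated_fourier f (r : R) (xi : 'rV[R]_n) : R[i] :=
  cintegral [set x | enorm x <= r]
    (fun x => f x * Complex (cos (dotv x xi)) (- sin (dotv x xi))).

(* For f in L^2, the Fourier-Plancherel transform of f is the L^2-limit of its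
   truncated Fourier integrals; it is determined up to a null set. *)
Definition is_fourier f g : Prop :=
  in_L2 g /\
  L2enorm (fun xi => truncated_fourier f k%:R xi - g xi) @[k --> \oo] --> 0%E.

Definition band_limited (sigma : R) f : Prop :=
  in_L2 f /\ exists2 g, is_fourier f g &
    {ae lebesgue_rV n, forall xi, sigma < enorm xi -> g xi = 0}.

End band_limited.

Section interpolation.
Variables (R : realType) (n : nat).

Definition gaussian (beta : R) (x : 'rV[R]_n) : R :=
  expR (- (beta * enorm x ^+ 2)).

Definition gaussian_interpolant (beta : R) (N : nat) (X : 'I_N -> 'rV[R]_n)
    (f s : 'rV[R]_n -> R[i]) : Prop :=
  exists c : 'I_N -> R[i],
    (forall x, s x = \sum_j c j * (gaussian beta (x - X j))%:C%C) /\
    (forall i, s (X i) = f (X i)).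

Definition nondegenerate (v : 'I_n.+1 -> 'rV[R]_n) : bool :=
  row_free (\matrix_(i < n) (v (lift ord0 i) - v ord0)).

Definition simplex (v : 'I_n.+1 -> 'rV[R]_n) : set 'rV[R]_n :=
  [set p | exists t : 'I_n.+1 -> R,
    [/\ forall i, 0 <= t i, \sum_i t i = 1 & p = \sum_i t i *: v i]].

(* There are no evenly spaced points of degree 0, the weights k_i / l being
   undefined for l = 0. *)
Definition evenly_spaced (v : 'I_n.+1 -> 'rV[R]_n) (l : nat) : set 'rV[R]_n :=
  [set p | exists k : 'I_n.+1 -> nat,
    [/\ (0 < l)%N, (\sum_i k i)%N = l &
        p = \sum_i ((k i)%:R / l%:R) *: v i]].

Definition degree_range (b0 delta : R) (l : nat) : bool :=
  b0 / delta <= l%:R <= 2 * b0 / delta.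

Definition simplex_with_centers (b0 delta : R) (Omega X : set 'rV[R]_n)
    (x : 'rV[R]_n) (r : R) (v : 'I_n.+1 -> 'rV[R]_n) : Prop :=
  [/\ nondegenerate v, diam (simplex v) = r, simplex v x,
      simplex v `<=` Omega &
      forall l, degree_range b0 delta l -> evenly_spaced v l.-1 `<=` X].

Definition simplex_property (b0 delta : R) (Omega X : set 'rV[R]_n) : Prop :=
  forall x, Omega x -> forall r, b0 / 2 <= r <= b0 ->
  exists v, simplex_with_centers b0 delta Omega X x r v.

(* The version for a single fixed point x: one simplex around x, whose evenly
   spaced points are the only centers. *)
Definition simplex_property_at (b0 delta : R) (Omega X : set 'rV[R]_n)
    (x : 'rV[R]_n) : Prop :=
  exists r v, [/\ b0 / 2 <= r <= b0,
    simplex_with_centers b0 delta Omega X x r v &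
    X `<=` \bigcup_(l in [set l | degree_range b0 delta l])
             evenly_spaced v l.-1].

End interpolation.

Section error_bound.
Variable R : realType.

Let e : R := expR 1.

Definition rho : R := Num.sqrt 3 / e.

Definition rho3 (beta : R) : R := 12 `^ (4^-1) * Num.sqrt (e * beta).

Definition delta0 (b0 beta : R) : R :=
  Num.min b0 (rho3 beta ^+ 4 * 3 ^+ 3 * 2 ^+ 7 * b0 ^+ 3)^-1.

Definition beta0 (b0 delta : R) : R :=
  (144 * Num.sqrt 2 * e * b0 `^ (3 / 2) * Num.sqrt delta)^-1.

Definition Delta'' (n : nat) : R :=
  let a := Num.sqrt (n%:R * unit_ball_volume R n) in
  if odd n then
    Num.sqrt (2 + e^-1) * pi `^ ((n%:R - 1) / 4) * a *
    2 `^ (n%:R / 4) * rho `^ ((n%:R - 1) / 4)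
  else
    pi `^ ((n%:R - 1) / 4) * a *
    2 `^ ((n%:R + 1) / 4) * rho `^ ((n%:R - 2) / 4).

Definition c1 (n : nat) (b0 : R) : R :=
  Delta'' n / (Num.sqrt (16 * pi) * Num.sqrt b0).

Definition c2 (b0 beta : R) : R := rho3 beta ^+ 4 * 3 ^+ 3 * 2 ^+ 7 * b0 ^+ 3.

Definition c3 (b0 : R) : R := b0 / 4.

Definition error_bound (n : nat) (b0 delta sigma : R)
    (f : 'rV[R]_n -> R[i]) (beta : R) : R :=
  c1 n b0 * Num.sqrt delta * (c2 b0 beta * delta) `^ (c3 b0 / delta) *
  (2 * pi) ^- n * expR (sigma ^+ 2 / (8 * beta)) * L2norm f.

Definition MN (b0 delta sigma beta : R) : R :=
  beta `^ (b0 / (2 * delta)) * expR (sigma ^+ 2 / (8 * beta)).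

Definition minimizer_on (D : set R) (F : R -> R) (beta : R) : Prop :=
  D beta /\ forall beta', D beta' -> F beta <= F beta'.

Definition optimal_shape (n : nat) (b0 delta sigma : R)
    (f : 'rV[R]_n -> R[i]) (D : set R) (beta : R) : Prop :=
  minimizer_on D (error_bound b0 delta sigma f) beta.

Lemma le_delta0 (b0 delta beta : R) : 0 < b0 -> 0 < delta -> 0 < beta ->
  (delta <= delta0 b0 beta) = (delta <= b0) && (beta <= beta0 b0 delta).
Proof.
move=> b0_gt0 delta_gt0 beta_gt0; rewrite /delta0 le_min; congr andb.
have e_gt0 : 0 < e by exact: expR_gt0.
have rho4 : rho3 beta ^+ 4 = 12 * (e * beta) ^+ 2.
  have r4 : (12 `^ (4^-1) : R) ^+ 4 = 12.
    by rewrite -(@powR_mulrn _ (12 `^ _)) ?powR_ge0// -powRrM mulVf// powRr1.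
  rewrite /rho3 exprMn r4 (exprM _ 2 2) sqr_sqrtr//.
  by rewrite mulr_ge0// ltW.
rewrite /beta0; set A := _ * b0 ^+ 3; set K := 144 * _ * _ * _ * _.
have A_gt0 : 0 < A by rewrite /A rho4 !mulr_gt0 ?exprn_gt0 ?mulr_gt0.
have K_gt0 : 0 < K by rewrite /K !mulr_gt0 ?powR_gt0 ?sqrtr_gt0.
have AK : A * delta = (K * beta) ^+ 2.
  have b3 : (b0 `^ (3 / 2)) ^+ 2 = b0 ^+ 3.
    rewrite -(@powR_mulrn _ (b0 `^ _)) ?powR_ge0// -powRrM divfK//.
    by rewrite powR_mulrn// ltW.
  rewrite /A /K rho4 !exprMn b3 !sqr_sqrtr ?ltW//.
  ring.
rewrite -[A^-1]mul1r ler_pdivlMr// mulrC AK.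
rewrite -[K^-1]mul1r ler_pdivlMr// [beta * K]mulrC.
by rewrite -[X in _ <= X](expr1n _ 2) ler_pXn2r// ?nnegrE ?ler01// mulr_ge0 ?ltW.
Qed.

End error_bound.

(* Main.v *)
Require Import Defs.
From mathcomp Require Import all_boot all_order all_algebra.
From mathcomp Require Import all_classical all_reals all_analysis.
From mathcomp Require Import complex.
From mathcomp Require Import ring lra.
Import Order.TTheory GRing.Theory Num.Theory.
Local Open Scope classical_set_scope.
Local Open Scope ring_scope.

(** For every [beta > 0] one has [c2 * delta = (beta / beta0) ^ 2], so the error
bound is a constant multiple of [MN]; the constant is positive when [f <> 0]
because the unit ball has positive finite volume.  With [a = b0 / (2 delta)] and
[c = sigma^2 / 8], [MN] is the exponential of [G beta = a ln beta + c / beta].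
Put [m = min (c / a) beta0].  Since [ln (m / beta) < m / beta - 1] unless
[beta = m], [G beta - G m > (beta - m) (a - c / m) / beta >= 0] for every other
[beta] in [(0, beta0]], so [m] is the only minimizer. *)

Lemma powR_expR_div_gt {R : realType} (a c m beta : R) :
  0 < m -> 0 < beta -> beta != m -> 0 <= (beta - m) * (a - c / m) -> 0 < a ->
  m `^ a * expR (c / m) < beta `^ a * expR (c / beta).
Proof.
move=> m_gt0 beta_gt0 neq_betam sgn a_gt0.
rewrite /powR !gt_eqF// -!expRD ltr_expR.
have ln_lt : 1 + (ln m - ln beta) < m / beta.
  rewrite -ln_div ?posrE//.
  rewrite -[ltRHS]lnK ?posrE ?divr_gt0//; apply: expR_gt1Dx.
  rewrite ln_eq0 ?divr_gt0//; apply: contra neq_betam => /eqP mb.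
  by rewrite -[m](divfK (lt0r_neq0 beta_gt0)) mb mul1r.
(* This is the difference of the two exponents after [a * (ln beta - ln m)] has been replaced by its
   lower bound [a * (1 - m / beta)]. *)
have lin : 0 <= a * (1 - m / beta) + (c / beta - c / m).
  rewrite (_ : _ + _ = (beta - m) * (a - c / m) / beta); last first.
    by field; rewrite !gt_eqF.
  by rewrite divr_ge0// ltW.
have : a * (1 + (ln m - ln beta)) < a * (m / beta) by rewrite ltr_pM2l.
move: lin; rewrite !mulrDr mulrN.
lra.
Qed.

(** Multiplying by a nonnegative constant preserves inequalities. It serves with a constant [K] to
    pass from [MN] to the error bound, and with [K^-1] to come back. *)
Lemma minimizer_on_scale {R : realType} (D : set R) (F G : R -> R) (K : R) :
  0 <= K -> (forall b, D b -> G b = K * F b) ->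
  forall b, minimizer_on D F b -> minimizer_on D G b.
Proof.
move=> K_ge0 GE b [Db minb]; split=> // b' Db'.
by rewrite !GE// ler_wpM2l// minb.
Qed.

Lemma powR_expR_div_minimizer {R : realType} (a c B : R) :
  0 < a -> 0 < c -> 0 < B ->
  exists! beta, minimizer_on [set beta | 0 < beta <= B]
    (fun beta => beta `^ a * expR (c / beta)) beta.
Proof.
move=> a_gt0 c_gt0 B_gt0; pose m := Num.min (c / a) B.
have m_gt0 : 0 < m by rewrite lt_min divr_gt0.
have gtm beta : 0 < beta <= B -> beta != m ->
    m `^ a * expR (c / m) < beta `^ a * expR (c / beta).
  move=> /andP[beta_gt0 betaB] neq; apply: powR_expR_div_gt => //.
  (* If [c / a <= B], then [m] is the critical point and [a - c / m] vanishes. Otherwise [m = B] is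
     the right endpoint, and both factors are nonpositive. *)
  rewrite /m; have [_|Bca] := leP (c / a) B.
    by rewrite invf_div mulrCA divff ?gt_eqF// mulr1 subrr mulr0.
  rewrite mulr_le0// subr_le0//.
  by rewrite ler_pdivlMr// mulrC -ler_pdivlMr// ltW.
have mI : 0 < m <= B by rewrite m_gt0 ge_min lexx orbT.
exists m; split.
  by split=> // beta Ibeta; have [->//|/(gtm _ Ibeta)/ltW] := eqVneq beta m.
move=> beta [Ibeta minbeta]; apply/eqP; rewrite eq_sym.
apply/negPn/negP => /(gtm _ Ibeta); apply/negP.
by rewrite -leNgt; exact: minbeta.
Qed.

Section unit_ball.
Variables (R : realType) (n : nat).

Lemma dotv_ge0 (x : 'rV[R]_n) : 0 <= dotv x x.
Proof. by apply: sumr_ge0 => i _; rewrite -expr2 sqr_ge0. Qed.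

Lemma enorm_le1 (x : 'rV[R]_n) : (enorm x <= 1) = (dotv x x <= 1).
Proof. by rewrite /enorm -[X in _ <= X]sqrtr1 ler_sqrt. Qed.

Lemma measurable_unit_ball : measurable [set x : 'rV[R]_n | enorm x <= 1].
Proof.
have mdot : measurable_fun [set: 'rV[R]_n] (fun x => dotv x x).
  apply: measurable_sum => i.
  by apply: measurable_realfun.measurable_funM; exact: measurable_coord.
rewrite (_ : mkset _ = (fun x => dotv x x) @^-1` `]-oo, 1]).
  by rewrite -[X in measurable X]setTI; apply: mdot => //; exact: measurable_itv.
by apply/seteqP; split=> x /=; rewrite in_itv /= enorm_le1.
Qed.

(** The ball lies between two cubes centred at the origin, whose volumes are positive and finite. *)
Lemma unit_ball_volume_gt0 : 0 < unit_ball_volume R n.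
Proof.
pose cube (r : R) :=
  [set x : 'rV[R]_n | forall i, (const_mx (- r) : 'rV_n) ord0 i <= x ord0 i
                                  <= (const_mx r : 'rV_n) ord0 i].
have cubeP r : 0 < r ->
    measurable (cube r) /\ lebesgue_rV n (cube r) = ((r + r) ^+ n)%:E.
  move=> r_gt0.
  have lt i : (const_mx (- r) : 'rV[R]_n) ord0 i < (const_mx r : 'rV_n) ord0 i.
    by rewrite !mxE gtrN.
  have [mcube ->] := lebesgue_rV_box lt; split=> //.
  under eq_bigr do rewrite !mxE opprK.
  by rewrite prodr_const card_ord.
(* With [|x i| <= r <= 1] each square is at most [r], so the sum of squares is at most [n * r <= 1].
   Dividing by [n.+1] keeps [r] positive when [n] is 0. *)
pose r : R := n.+1%:R^-1.
have r_gt0 : 0 < r by rewrite invr_gt0.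
have [mr vr] := cubeP r r_gt0.
have [m1 v1] := cubeP 1 ltr01.
have inner : cube r `<=` [set x | enorm x <= 1].
  move=> x xr /=; rewrite enorm_le1.
  have : dotv x x <= \sum_(i < n) r.
    apply: ler_sum => i _; have := xr i; rewrite !mxE -ler_norml => xir.
    rewrite -expr2 -real_normK ?num_real// expr2.
    have r_le1 : r <= 1 by rewrite invf_le1 ?ler1n.
    by rewrite -[leRHS]mulr1 ler_pM// (le_trans xir).
  move=> /le_trans; apply; rewrite sumr_const card_ord -mulr_natl.
  by rewrite ler_pdivrMr// mul1r ler_nat.
have outer : [set x | enorm x <= 1] `<=` cube 1.
  move=> x /=; rewrite enorm_le1 => x1 i; rewrite !mxE -ler_norml.
  rewrite -(ler_pXn2r (ltn0Sn 1)) ?nnegrE// expr1n real_normK ?num_real//.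
  apply: le_trans x1; rewrite /dotv (bigD1 i)//= -expr2 lerDl.
  by apply: sumr_ge0 => j _; rewrite -expr2 sqr_ge0.
have mball := measurable_unit_ball.
(* Finiteness matters as much as positivity: [fine] sends an infinite volume to 0. *)
apply: fine_gt0; apply/andP; split.
  apply: (@lt_le_trans _ _ (lebesgue_rV n (cube r))).
    by rewrite vr lte_fin exprn_gt0// addr_gt0.
  by apply: le_measure => //; rewrite inE.
apply: (@le_lt_trans _ _ (lebesgue_rV n (cube 1))).
  by apply: le_measure => //; rewrite inE.
by rewrite v1 ltry.
Qed.

End unit_ball.

Lemma L2norm_ge0 {R : realType} (n : nat) (f : 'rV[R]_n -> R[i]) : 0 <= L2norm f.
Proof. by rewrite fine_ge0// Lnorm_ge0. Qed.

Section error_bound_MN.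
Variable R : realType.

Lemma Delta''_gt0 (n : nat) : (0 < n)%N -> 0 < Delta'' R n.
Proof.
move=> n_gt0.
have a_gt0 : 0 < Num.sqrt (n%:R * unit_ball_volume R n).
  by rewrite sqrtr_gt0 mulr_gt0 ?ltr0n ?unit_ball_volume_gt0.
have rho_gt0 : 0 < rho R by rewrite divr_gt0 ?sqrtr_gt0.
have pi0 := pi_gt0 R.
rewrite /Delta''; by case: ifP => _; rewrite !mulr_gt0 ?powR_gt0.
Qed.

(** [rho3] is proportional to the square root of [beta] and enters [c2] through its fourth power. *)
Lemma c2E (b0 beta : R) : 0 <= beta -> c2 b0 beta = c2 b0 1 * beta ^+ 2.
Proof.
move=> beta_ge0; have e_ge0 := expR_ge0 (1 : R).
have rho4 b : 0 <= b ->
    rho3 b ^+ 4 = (12 `^ 4^-1) ^+ 4 * (expR 1 * b) ^+ 2.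
  move=> b_ge0; rewrite /rho3 exprMn [X in _ * X](exprM _ 2 2) sqr_sqrtr//.
  by rewrite mulr_ge0.
by rewrite /c2 !rho4//; ring.
Qed.

Lemma c2_gt0 (b0 beta : R) : 0 < b0 -> 0 < beta -> 0 < c2 b0 beta.
Proof.
move=> b0_gt0 beta_gt0.
have rho3_gt0 : 0 < rho3 beta.
  by rewrite mulr_gt0 ?powR_gt0 ?sqrtr_gt0 ?mulr_gt0 ?expR_gt0.
rewrite /c2; apply: mulr_gt0; last exact: exprn_gt0.
by do 2 (apply: mulr_gt0; last exact: exprn_gt0); exact: exprn_gt0.
Qed.

Lemma beta0_gt0 (b0 delta : R) : 0 < b0 -> 0 < delta -> 0 < beta0 b0 delta.
Proof.
move=> b0_gt0 delta_gt0.
by rewrite invr_gt0 !mulr_gt0 ?sqrtr_gt0 ?expR_gt0 ?powR_gt0.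
Qed.

(** The part of the error bound that depends on neither [beta] nor [f]; [c2] is frozen at shape
    parameter 1. *)
Definition error_factor (n : nat) (b0 delta : R) : R :=
  c1 n b0 * Num.sqrt delta * (c2 b0 1 * delta) `^ (c3 b0 / delta) *
  (2 * pi) ^- n.

Lemma error_factor_gt0 (n : nat) (b0 delta : R) :
  (0 < n)%N -> 0 < b0 -> 0 < delta -> 0 < error_factor n b0 delta.
Proof.
move=> n_gt0 b0_gt0 delta_gt0; have pi0 := pi_gt0 R.
rewrite !mulr_gt0 ?Delta''_gt0 ?invr_gt0 ?mulr_gt0 ?sqrtr_gt0 ?mulr_gt0//.
  by rewrite powR_gt0 ?mulr_gt0 ?c2_gt0.
by rewrite exprn_gt0 ?mulr_gt0.
Qed.

(** The factor [beta ^+ 2] of [c2], raised to [c3 b0 / delta = b0 / (4 * delta)], gives exactly the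
    power of [beta] in [MN]. *)
Lemma error_boundE {n : nat} (b0 delta sigma : R) (f : 'rV[R]_n -> R[i])
    (beta : R) : 0 < b0 -> 0 < delta -> 0 < beta ->
  error_bound b0 delta sigma f beta =
  error_factor n b0 delta * L2norm f * MN b0 delta sigma beta.
Proof.
move=> b0_gt0 delta_gt0 beta_gt0; rewrite /error_bound.
have -> : (c2 b0 beta * delta) `^ (c3 b0 / delta) =
    (c2 b0 1 * delta) `^ (c3 b0 / delta) * beta `^ (b0 / (2 * delta)).
  rewrite c2E ?ltW// mulrAC [LHS]powRM ?mulr_ge0 ?sqr_ge0 ?ltW ?c2_gt0//.
  rewrite -(@powR_mulrn _ beta 2) ?ltW// -powRrM; congr (_ * _ `^ _).
  by rewrite /c3; field; rewrite gt_eqF.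
by rewrite /error_factor /MN; ring.
Qed.

End error_bound_MN.

Theorem mainTheorem3 (R : realType) (n : nat) (hn : (1 <= n)%N)
    (sigma : R) (hsigma : 0 < sigma)
    (f : 'rV[R]_n -> R[i]) (hf : band_limited sigma f)
    (b0 : R) (hb0 : 0 < b0)
    (delta : R) (hdelta : 0 < delta <= b0)
    (N : nat) (X : 'I_N -> 'rV[R]_n) (hX : injective X)
    (Omega : set 'rV[R]_n) (x : 'rV[R]_n) (hx : Omega x)
    (hOmega : simplex_property b0 delta Omega (range X) \/
              simplex_property_at b0 delta Omega (range X) x)
    (s : R -> 'rV[R]_n -> R[i])
    (hs : forall beta, 0 < beta -> delta <= delta0 b0 beta ->
          gaussian_interpolant beta X f (s beta)) :
  let I := [set beta : R | 0 < beta <= beta0 b0 delta] in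
  [/\ exists! beta, minimizer_on I (MN b0 delta sigma) beta,
      forall beta, minimizer_on I (MN b0 delta sigma) beta ->
        optimal_shape b0 delta sigma f I beta &
      L2norm f <> 0 -> forall beta, optimal_shape b0 delta sigma f I beta ->
        minimizer_on I (MN b0 delta sigma) beta].
Proof.
have /andP[delta_gt0 _] := hdelta; move=> I.
pose K := error_factor R n b0 delta * L2norm f.
have factor_gt0 := error_factor_gt0 R n b0 delta hn hb0 delta_gt0.
have boundE beta : I beta ->
    error_bound b0 delta sigma f beta = K * MN b0 delta sigma beta.
  by case/andP=> beta_gt0 _; exact: error_boundE.
split.
- have -> : MN b0 delta sigma = fun beta =>
      beta `^ (b0 / (2 * delta)) * expR (sigma ^+ 2 / 8 / beta).
    by apply/funext => beta; rewrite /MN [(8 * _)^-1]invfM mulrA.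
  apply: powR_expR_div_minimizer; last exact: beta0_gt0.
    by rewrite divr_gt0 ?mulr_gt0.
  by rewrite divr_gt0 ?exprn_gt0.
- apply: (minimizer_on_scale _ _ _ K) => //.
  by apply: mulr_ge0; [exact: ltW|exact: L2norm_ge0].
- move=> /eqP normf_neq0.
  (* A nonzero norm makes [K] invertible. If the norm were 0, the bound would vanish on all of [I]
     and every point would be optimal. *)
  have K_neq0 : K != 0 by rewrite mulf_neq0// gt_eqF.
  apply: (minimizer_on_scale _ _ _ K^-1).
    by rewrite invr_ge0; apply: mulr_ge0; [exact: ltW|exact: L2norm_ge0].
  by move=> beta /boundE ->; rewrite mulKf.
Qed.
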